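(* Let $X$ be a real Banach space and $Y$ a closed linear subspace of $X$. Then the following are equivalent: (a) $Y$ has $n.X.I.P.$ in $X$ for all $n\in\mathbb{N}$. (b) $Y$ has restricted $n.X.I.P.$ in $X$ for all $n\in\mathbb{N}$. (c) $\mathrm{rad}_Y(F)=\mathrm{rad}_X(F)$ for all nonempty finite subsets (finite tuples) $F$ of $Y$. (d) $\mathrm{rad}_Y^f(F)=\mathrm{rad}_X^f(F)$ for all $n\ge1$, all $n$-tuples $F=(y_1,\dots,y_n)$ of elements of $Y$, and all continuous, monotone functions $f:\mathbb{R}^n_{\ge0}\to\mathbb{R}_{\ge0}$.
   Context: $B_X(a,r)$ and $B_Y(a,r)$ denote closed balls in $X$ and $Y$. $Y$ has $n.X.I.P.$ in $X$ if for all $a_1,\dots,a_n\in Y$ and $r_1,\dots,r_n>0$ with $\bigcap_{i=1}^nB_X(a_i,r_i)\ne\emptyset$ one has $\bigcap_{i=1}^nB_Y(a_i,r_i+\varepsilon)\ne\emptyset$ for all $\varepsilon>0$. $Y$ has restricted $n.X.I.P.$ in $X$ if for all $a_1,\dots,a_n\in Y$ and $r>0$ with $\bigcap_{i=1}^nB_X(a_i,r)\ne\emptyset$ one has $\bigcap_{i=1}^nB_Y(a_i,r+\varepsilon)\ne\emptyset$ for all $\varepsilon>0$. A function $f:\mathbb{R}^n_{\ge0}\to\mathbb{R}_{\ge0}$ is monotone if $s\le t$ coordinatewise implies $f(s)\le f(t)$. For a tuple $F=(y_1,\dots,y_n)$ and a subspace $Z$ ($Z=X$ or $Z=Y$), $\mathrm{rad}_Z^f(F)=\inf_{z\in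 Z}f(\|z-y_1\|,\dots,\|z-y_n\|)$ and $\mathrm{rad}_Z(F)=\inf_{z\in Z}\max_{i}\|z-y_i\|$. *)

(* Defs.v *)
From HB Require Import structures.
From mathcomp Require Import all_boot all_order all_algebra.
From mathcomp Require Import all_classical all_reals all_analysis.
Set Implicit Arguments.
Unset Strict Implicit.
Unset Printing Implicit Defensive.
Import Order.TTheory GRing.Theory Num.Theory.
Import numFieldNormedType.Exports.
Local Open Scope classical_set_scope.
Local Open Scope ring_scope.

Section Defs.
Variables (R : realType) (X : normedModType R).
Implicit Types (Y Z : set X).

Definition closed_subspace Y : Prop :=
  submod_closed [in Y] /\ closed Y.

(* [closed_ball a r] is the closure of the open ball; for 0 < r, the only case
   used, closed_ballE identifies it with the x such that `|a - x| <= r. *)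
Definition ball_in Z (a : X) (r : R) : set X := Z `&` closed_ball a r.

Definition nXIP (n : nat) Y : Prop :=
  forall (a : 'I_n -> X) (r : 'I_n -> R),
    (forall i, Y (a i)) -> (forall i, 0 < r i) ->
    \bigcap_(i in [set: 'I_n]) closed_ball (a i) (r i) !=set0 ->
    forall e : R, 0 < e ->
      \bigcap_(i in [set: 'I_n]) ball_in Y (a i) (r i + e) !=set0.

Definition restricted_nXIP (n : nat) Y : Prop :=
  forall (a : 'I_n -> X) (r : R),
    (forall i, Y (a i)) -> 0 < r ->
    \bigcap_(i in [set: 'I_n]) closed_ball (a i) r !=set0 ->
    forall e : R, 0 < e ->
      \bigcap_(i in [set: 'I_n]) ball_in Y (a i) (r + e) !=set0.

(* The default value 0 of the iterated maximum is harmless: norms are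
   nonnegative and only families with n > 0 are considered. *)
Definition cheb_rad (n : nat) Z (y : 'I_n -> X) : R :=
  inf [set \big[Num.max/0]_(i < n) `|z - y i| | z in Z].

Definition cheb_radf (n : nat) (f : 'rV[R]_n -> R) Z (y : 'I_n -> X) : R :=
  inf [set f (\row_i `|z - y i|) | z in Z].

End Defs.

Definition orthant (R : realType) (n : nat) : set 'rV[R]_n :=
  [set t | forall i, 0 <= t ord0 i].
Arguments orthant : clear implicits.

(* A function from the orthant to the nonnegative reals is represented by a
   total function on 'rV[R]_n; only its restriction to the orthant is
   constrained. *)
Definition orthant_fun (R : realType) (n : nat) (f : 'rV[R]_n -> R) : Prop :=
  forall t, orthant R n t -> 0 <= f t.

Definition orthant_monotone (R : realType) (n : nat) (f : 'rV[R]_n -> R) :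
    Prop :=
  forall s t, orthant R n s -> orthant R n t ->
    (forall i, s ord0 i <= t ord0 i) -> f s <= f t.

(* Main.v *)
Require Import Defs.
From HB Require Import structures.
From mathcomp Require Import all_boot all_order all_algebra.
From mathcomp Require Import all_classical all_reals all_analysis.
From mathcomp Require Import lra.
Set Implicit Arguments.
Unset Strict Implicit.
Import Order.TTheory GRing.Theory Num.Theory.
Import numFieldNormedType.Exports.
Local Open Scope classical_set_scope.
Local Open Scope ring_scope.

(** Each of the conditions on radii reduces to the intersection property for
    balls of arbitrary radii, by choosing a suitable gauge f; the substance of
    the theorem is that equal radii suffice.

    Equal radii suffice (restricted_nXIP_nXIP).  Let x be at distance at most
    r_i from a_i, for each i, and let M exceed all the r_i.  For any u_i in
    the unit ball of Y, x lies in all the balls of the common radius M centred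
    at a_i - (M - r_i) u_i, so the restricted property gives y in Y with
    |y - a_i + (M - r_i) u_i| <= M + e.  Such a y need not be close to a_i, but
    if u_i has norm 1, a norming functional of u_i is at most r_i + e at
    y - a_i: the bound is the right one in the direction u_i, and averaging
    gives it in norm.  Choose points y_1, y_2, ... of Y one after the other,
    where u_i is, at each step, the direction of the sum v of the y_k - a_i
    obtained so far.  While |v| < M - r_i, a shorter u_i with
    (M - r_i) u_i = v keeps the next sum below M + e.  As soon as
    |v| >= M - r_i, the next step adds at most r_i + e to |v|:
    the multiple (M - r_i) u_i taken away from v shortens it by exactly
    M - r_i, and adding it to y - a_i gives a vector of norm at most M + e.
    Hence the sum of m terms has norm at most M + m (r_i + e), and the mean of
    the y_k lies within r_i + e + M / m of a_i, for all i at once.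

    From intersections to radii (nXIP_cheb_radf).  If f almost attains its
    infimum at z, the balls B(a_i, |z - a_i|) meet; a point of Y in slightly
    larger balls has, by monotonicity and continuity, almost the same value of
    f.

    From radii to intersections.  The balls B(a_i, r_i) have a common point
    exactly when f(t) = max(0, max_i (t_i - r_i)) vanishes somewhere, and a
    point of Y with a small value of f lies in slightly larger balls.  The same
    f with r = 0 gives the Chebyshev radius, since the sublevel sets of the
    largest distance to the a_i are intersections of balls of equal radii. *)

(** * Closed balls *)

Lemma closed_ball_normE (R : realType) (X : normedModType R) (a x : X) (r : R) :
  0 < r -> closed_ball a r x <-> `|x - a| <= r.
Proof. by move=> r0; rewrite closed_ballE// /closed_ball_ /= distrC. Qed.

Lemma ball_in_normE (R : realType) (X : normedModType R) (Z : set X)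
    (a x : X) (r : R) :
  0 < r -> ball_in Z a r x <-> Z x /\ `|x - a| <= r.
Proof.
move=> r0; split=> -[Zx /(closed_ball_normE _ _ r0)]; first by [].
by move=> xar; split=> //; apply/(closed_ball_normE _ _ r0).
Qed.

(** * From equal radii to arbitrary radii *)

(** Truncating v at length l: the truncated vector is l times a vector of the
    unit ball, and what remains of v is shorter than v by l, or 0 if |v| is at
    most l. *)
Lemma norm_sub_truncation (R : realType) (X : normedModType R) (v : X) (l : R) :
  0 < l ->
  `|v - l *: ((Num.max `|v| l)^-1 *: v)| = Num.max `|v| l - l.
Proof.
move=> l0; set N := Num.max `|v| l.
have N0 : 0 < N by rewrite lt_max l0 orbT.
rewrite scalerA -{1}(scale1r v) -scalerBl normrZ ger0_norm; last first.
  by rewrite subr_ge0 ler_pdivrMr// mul1r le_max lexx orbT.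
have [vl|lv] := leP `|v| l.
  have -> : N = l by rewrite /N; apply/max_idPr.
  by rewrite divff ?gt_eqF// !subrr mul0r.
have NE : N = `|v| by rewrite /N; apply/max_idPl/ltW.
by rewrite mulrBl mul1r -NE mulfVK ?gt_eqF.
Qed.

Section RestrictedToGeneral.
Variables (R : realType) (X : normedModType R) (Y : set X) (n : nat).
Hypothesis linY : submod_closed [in Y].
Hypothesis rXIP : restricted_nXIP n Y.
Variables (a : 'I_n -> X) (r : 'I_n -> R) (x : X) (M e : R).
Hypothesis Ya : forall i, Y (a i).
Hypothesis xar : forall i, `|x - a i| <= r i.
Hypotheses (M0 : 0 < M) (rM : forall i, r i < M) (e0 : 0 < e).

Let Y0 : Y 0. Proof. by have /set_mem := linY.1. Qed.

Let YZD c u v : Y u -> Y v -> Y (c *: u + v).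
Proof.
by move=> Yu Yv; apply/set_mem/linY.2; [apply/mem_set: Yu|apply/mem_set: Yv].
Qed.

(** The common point x witnesses that the balls of radius M around the
    displaced centres meet: moving a_i by at most M - r_i is compensated by the
    larger radius. *)
Lemma exists_in_displaced_balls (u : 'I_n -> X) :
  (forall i, Y (u i)) -> (forall i, `|u i| <= 1) ->
  exists2 y, Y y & forall i, `|y - a i + (M - r i) *: u i| <= M + e.
Proof.
move=> Yu u1.
have [|y yP] := @rXIP (fun i => - (M - r i) *: u i + a i) M
  (fun i => YZD _ (Yu i) (Ya i)) M0 _ e e0.
  exists x => i _; apply/closed_ball_normE => //.
  rewrite opprD scaleNr opprK addrCA addrC.
  apply: le_trans (ler_normD _ _) _.
  have lM : 0 <= M - r i by rewrite subr_ge0 ltW.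
  rewrite normrZ (ger0_norm lM).
  have := xar i; have := ler_wpM2l lM (u1 i); rewrite mulr1; lra.
have Me0 : 0 < M + e by rewrite addr_gt0.
have {}yP i : Y y /\ `|y - a i + (M - r i) *: u i| <= M + e.
  have /(ball_in_normE _ _ _ Me0)[Yy] := yP i I.
  by rewrite opprD scaleNr opprK addrCA addrC.
case: (pselect (exists i : 'I_n, True)) => [[i _]|n0].
  by exists y => [|j]; [exact: (yP i).1|exact: (yP j).2].
by exists 0 => // i; case: n0; exists i.
Qed.

(** The sum s stands for y_1 + ... + y_m: the m displacements s - m a_i grow
    at the rate r_i + e, up to a constant that the choice of M provides. *)
Lemma exists_sum_near_multiples (m : nat) :
  exists2 s, Y s & forall i, `|s - m%:R *: a i| <= M + m%:R * (r i + e).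
Proof.
elim: m => [|m [s Ys sP]].
  by exists 0 => // i; rewrite scale0r subrr normr0 mul0r addr0 ltW.
pose v i := s - m%:R *: a i.
pose u i := (Num.max `|v i| (M - r i))^-1 *: v i.
have l0 i : 0 < M - r i by rewrite subr_gt0.
have N0 i : 0 < Num.max `|v i| (M - r i) by rewrite lt_max l0 orbT.
have Yu i : Y (u i).
  rewrite /u -[X in Y X]addr0; apply: YZD => //.
  by rewrite /v addrC -scaleNr; exact: YZD.
have u1 i : `|u i| <= 1.
  rewrite /u normrZ gtr0_norm ?invr_gt0//.
  by rewrite ler_pdivrMl// mulr1 le_max lexx.
have [y Yy yP] := exists_in_displaced_balls Yu u1.
exists (s + y) => [|i]; first by rewrite -[s]scale1r; exact: YZD.
have -> : s + y - m.+1%:R *: a i =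
    (y - a i + (M - r i) *: u i) + (v i - (M - r i) *: u i).
  rewrite addrACA subrr addr0 /v -natr1 scalerDl scale1r.
  by rewrite opprD addrACA [RHS]addrC.
apply: le_trans (ler_normD _ _) _.
have := norm_sub_truncation (v i) (l0 i); rewrite -/(u i) => ->.
have := yP i; have := sP i; rewrite -/(v i) -natr1 mulrDl mul1r.
have r0 : 0 <= r i := le_trans (normr_ge0 _) (xar i).
have : 0 <= m%:R * (r i + e) by rewrite mulr_ge0// addr_ge0// ltW.
have := l0 i.
case: (leP `|v i| (M - r i)); lra.
Qed.

End RestrictedToGeneral.

Lemma restricted_nXIP_nXIP (R : realType) (X : normedModType R) (Y : set X)
    (n : nat) :
  submod_closed [in Y] -> restricted_nXIP n Y -> nXIP n Y.
Proof.
move=> linY rXIP a r Ya r0 [x xP] e e0.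
have xar i : `|x - a i| <= r i by apply/closed_ball_normE => //; exact: xP.
pose M := 1 + \sum_i r i.
have rM i : r i < M.
  rewrite /M (bigD1 i)//=.
  have : 0 <= \sum_(j | j != i) r j by apply: sumr_ge0 => j _; exact: ltW.
  lra.
have M0 : 0 < M.
  by rewrite /M ltr_wpDr// sumr_ge0// => i _; exact: ltW.
have d0 : 0 < e / 2 by rewrite divr_gt0.
(* m makes the contribution M / m of the constant at most half of e *)
pose m := (Num.truncn (M / (e / 2))).+1.
have mM : M <= m%:R * (e / 2).
  by rewrite -ler_pdivrMr//; apply/ltW/truncnS_gt.
have m0 : 0 < m%:R :> R by rewrite ltr0n.
have [s Ys sP] := exists_sum_near_multiples linY rXIP Ya xar M0 rM d0 m.
exists (m%:R^-1 *: s) => i _; apply/ball_in_normE; first by rewrite addr_gt0.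
split.
  rewrite -[X in Y X]addr0; apply/set_mem/linY.2; first exact/mem_set.
  exact: linY.1.
have -> : m%:R^-1 *: s - a i = m%:R^-1 *: (s - m%:R *: a i).
  by rewrite scalerBr scalerA mulVf ?gt_eqF// scale1r.
rewrite normrZ gtr0_norm ?invr_gt0// ler_pdivrMl//.
apply: le_trans (sP i) _; lra.
Qed.

(** * Radii with respect to a gauge *)

Section Radii.
Variables (R : realType) (X : normedModType R) (n : nat).
Variables (f : 'rV[R]_n -> R) (y : 'I_n -> X).
Hypothesis f0 : orthant_fun f.

Let f_dist0 z : 0 <= f (\row_i `|z - y i|).
Proof. by apply: f0 => i; rewrite mxE. Qed.

Lemma cheb_radf_le (Z : set X) z :
  Z z -> cheb_radf f Z y <= f (\row_i `|z - y i|).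
Proof.
move=> Zz; apply: ge_inf; last by exists z.
by exists 0 => _ [w _ <-].
Qed.

Lemma cheb_radf_lt (Z : set X) c :
  Z !=set0 -> cheb_radf f Z y < c -> exists2 z, Z z & f (\row_i `|z - y i|) < c.
Proof.
move=> [z Zz] /inf_lt[|_ [w Zw <-] wc]; last by exists w.
by exists (f (\row_i `|z - y i|)), z.
Qed.

(** The form in which equality of radii is applied: a value of f taken on X is
    almost taken on Y. *)
Lemma cheb_radf_eq_approx (Y : set X) x c e :
  Y !=set0 -> cheb_radf f Y y = cheb_radf f setT y ->
  f (\row_i `|x - y i|) <= c -> 0 < e ->
  exists2 z, Y z & f (\row_i `|z - y i|) < c + e.
Proof.
move=> Yn0 fE fx e0; apply: cheb_radf_lt => //; rewrite fE.
apply: le_lt_trans (@cheb_radf_le setT x I) _.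
by rewrite (le_lt_trans fx)// ltrDl.
Qed.

End Radii.

(** Enlarging all the coordinates by the same small amount changes f by less
    than e; monotonicity transfers the bound to every point below. *)
Lemma orthant_continuous_right (R : realType) (n : nat) (f : 'rV[R]_n -> R)
    (t : 'rV[R]_n) (e : R) :
  {within orthant R n, continuous f} -> orthant R n t -> 0 < e ->
  exists2 d, 0 < d & f (\row_i (t ord0 i + d)) < f t + e.
Proof.
move=> /subspace_continuousP cf t0 e0.
have /cvgr_dist_lt/(_ _ e0) := cf t t0.
rewrite near_withinE => /nbhs_ballP[d /= d0 df].
have d20 : 0 < d / 2 by rewrite divr_gt0.
exists (d / 2) => //.
have /df : ball t d (\row_i (t ord0 i + d / 2)).
  split=> // i j; rewrite mxE (ord1 i) /ball /= opprD addNKr normrN.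
  by rewrite gtr0_norm//; lra.
move=> /(_ _)/ltr_distlCDr; apply=> i.
by rewrite mxE addr_ge0 ?t0 ?ltW.
Qed.

Lemma nXIP_cheb_radf (R : realType) (X : normedModType R) (Y : set X) (n : nat)
    (y : 'I_n -> X) (f : 'rV[R]_n -> R) :
  Y !=set0 -> (0 < n)%N -> nXIP n Y -> (forall i, Y (y i)) ->
  orthant_fun f -> {within orthant R n, continuous f} -> orthant_monotone f ->
  cheb_radf f Y y = cheb_radf f setT y.
Proof.
move=> Yn0 n0 XIP Yy f0 cf mf; apply/eqP; rewrite eq_le; apply/andP; split.
  apply/ler_addgt0Pr => e e0.
  have e20 : 0 < e / 2 by rewrite divr_gt0.
  have [||z _ zc] := @cheb_radf_lt _ _ _ f y setT (cheb_radf f setT y + e / 2).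
    by exists 0.
    by rewrite ltrDl.
  pose t : 'rV[R]_n := \row_i `|z - y i|.
  have t0 : orthant R n t by move=> i; rewrite mxE.
  have [d d0 fd] := orthant_continuous_right cf t0 e20.
  have d20 : 0 < d / 2 by rewrite divr_gt0.
  (* half of d makes the radii positive, the other half is the enlargement *)
  have rp i : 0 < `|z - y i| + d / 2 by rewrite ltr_wpDl.
  have [|w wP] := XIP y (fun i => `|z - y i| + d / 2) Yy rp _ _ d20.
    by exists z => i _; apply/closed_ball_normE => //; rewrite lerDl ltW.
  have {}wP i : Y w /\ `|w - y i| <= `|z - y i| + d.
    have wd : 0 < `|z - y i| + d / 2 + d / 2 by rewrite addr_gt0.
    have /(ball_in_normE _ _ _ wd)[Yw] := wP i I.
    by rewrite -addrA -splitr.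
  have Yw : Y w := (wP (Ordinal n0)).1.
  apply: le_trans (cheb_radf_le y f0 Yw) _.
  apply: (@le_trans _ _ (f (\row_i (t ord0 i + d)))).
    apply: mf => [i|i|i]; rewrite !mxE//; last exact: (wP i).2.
    by rewrite addr_ge0// ltW.
  by rewrite -/t in zc; lra.
apply: lb_le_inf.
  by case: Yn0 => z Yz; exists (f (\row_i `|z - y i|)), z.
by move=> _ [z Yz <-]; exact: cheb_radf_le.
Qed.

(** * The gauge that recognises intersections of balls *)

(** The least s >= 0 such that t lies below r + s. *)
Definition max_excess (R : realType) (n : nat) (r : 'I_n -> R)
    (t : 'rV[R]_n) : R :=
  \big[Num.max/0]_(i < n) (t ord0 i - r i).

Section MaxExcess.
Variables (R : realType) (n : nat) (r : 'I_n -> R).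

Lemma max_excess_leP (t : 'rV[R]_n) c :
  0 <= c -> max_excess r t <= c <-> forall i, t ord0 i <= r i + c.
Proof.
move=> c0; split=> [/bigmax_leP[_ tP] i|tP].
  by have := tP i isT; rewrite lerBlDl.
by apply/bigmax_leP; split=> // i _; rewrite lerBlDl.
Qed.

Lemma max_excess_ge0 : orthant_fun (max_excess r).
Proof. by move=> t _; exact: bigmax_ge_id. Qed.

Lemma max_excess_monotone : orthant_monotone (max_excess r).
Proof. by move=> s t _ _ st; apply: le_bigmax2 => i _; exact: lerB. Qed.

Lemma max_excess_continuous : continuous (max_excess r).
Proof.
rewrite /max_excess; elim: (index_enum _) => [|i s IHs].
  have -> : (fun t : 'rV[R]_n => \big[Num.max/0]_(j <- [::]) (t ord0 j - r j)) =
      cst 0 by apply/funext => t; rewrite big_nil.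
  by move=> t; exact: (@cst_continuous _ R).
have -> : (fun t : 'rV[R]_n =>
      \big[Num.max/0]_(j <- i :: s) (t ord0 j - r j)) =
    (fun t => t ord0 i - r i) \max
    (fun t => \big[Num.max/0]_(j <- s) (t ord0 j - r j)).
  by apply/funext => t; rewrite big_cons.
apply: max_fun_continuous IHs => t.
by apply: continuousB; [exact: coord_continuous|exact: cst_continuous].
Qed.

End MaxExcess.

(** Equality of radii for the gauge attached to r gives the intersection
    property for all the radii r_i + c. *)
Lemma max_excess_radius_balls (R : realType) (X : normedModType R)
    (Y : set X) (n : nat) (y : 'I_n -> X) (r : 'I_n -> R) (c : R) :
  Y !=set0 -> 0 <= c -> (forall i, 0 < r i + c) ->
  cheb_radf (max_excess r) Y y = cheb_radf (max_excess r) setT y ->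
  \bigcap_(i in [set: 'I_n]) closed_ball (y i) (r i + c) !=set0 ->
  forall e, 0 < e ->
  \bigcap_(i in [set: 'I_n]) ball_in Y (y i) (r i + c + e) !=set0.
Proof.
move=> Yn0 c0 rc0 fE [x xP] e e0.
have fx : max_excess r (\row_i `|x - y i|) <= c.
  apply/max_excess_leP => // i; rewrite mxE.
  by apply/closed_ball_normE => //; exact: xP.
have [z Yz /ltW zc] :=
  cheb_radf_eq_approx (@max_excess_ge0 _ _ _) Yn0 fE fx e0.
exists z => i _; apply/ball_in_normE; first by rewrite addr_gt0.
split=> //; move/max_excess_leP: zc => /(_ _ i).
by rewrite mxE addrA; apply; rewrite addr_ge0// ltW.
Qed.

Lemma cheb_radE (R : realType) (X : normedModType R) (n : nat) (Z : set X)
    (y : 'I_n -> X) :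
  cheb_rad Z y = cheb_radf (max_excess (fun=> 0)) Z y.
Proof.
congr inf; apply: eq_imagel => z _; apply: eq_bigr => i _.
by rewrite mxE subr0.
Qed.

(** * The equivalence *)

Theorem theorem2p6 (R : realType) (X : completeNormedModType R) (Y : set X)
  (hY : closed_subspace Y) :
  [<-> (* (a) *)
       forall n : nat, (0 < n)%N -> nXIP n Y;
       (* (b) *)
       forall n : nat, (0 < n)%N -> restricted_nXIP n Y;
       (* (c) *)
       forall (n : nat) (y : 'I_n -> X), (0 < n)%N -> (forall i, Y (y i)) ->
         cheb_rad Y y = cheb_rad [set: X] y;
       (* (d) *)
       forall (n : nat) (y : 'I_n -> X) (f : 'rV[R]_n -> R),
         (0 < n)%N -> (forall i, Y (y i)) ->
         orthant_fun f ->
         {within orthant R n, continuous f} ->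
         orthant_monotone f ->
         cheb_radf f Y y = cheb_radf f [set: X] y].
Proof.
have linY := hY.1.
have Yn0 : Y !=set0 by exists 0; have /set_mem := linY.1.
have cE n r : {within orthant R n, continuous (max_excess r)}.
  exact/continuous_subspaceT/max_excess_continuous.
tfae.
- by move=> XIP n n0 a r Ya r0; apply: XIP.
- move=> rXIP n y n0 Yy; rewrite !cheb_radE.
  apply: nXIP_cheb_radf => //; last exact: max_excess_monotone.
  + exact: restricted_nXIP_nXIP (rXIP n n0).
  + exact: max_excess_ge0.
- move=> radE n y f n0 Yy; apply: nXIP_cheb_radf => //.
  apply: restricted_nXIP_nXIP => // a r Ya r0.
  have := @max_excess_radius_balls _ _ Y n a (fun=> 0) r Yn0 (ltW r0).
  by rewrite add0r -!cheb_radE; apply=> //; exact: radE.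
- move=> radfE n n0 a r Ya r0 [x xP] e e0.
  have [i|||z zP] :=
    @max_excess_radius_balls _ _ Y n a r 0 Yn0 (lexx 0) _ _ _ e e0.
  + by rewrite addr0.
  + apply: radfE => //; last exact: max_excess_monotone.
    exact: max_excess_ge0.
  + by exists x => i _; rewrite addr0; exact: xP.
  + by exists z => i _; rewrite -(addr0 (r i)); exact: zP.
Qed.
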